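(* Suppose that $W_{\boldsymbol\lambda}$ is a conditionally positive definite (CPD) unilateral weighted shift with weights $\boldsymbol\lambda=\{\lambda_n\}_{n=0}^\infty$ and $(b,c,\nu)$ is its scalar representing triplet. Let $t\in(0,\infty)$. Then the following conditions are equivalent: (i) $W_{(t,\lambda_0,\lambda_1,\ldots)}$ is CPD, (ii) $\frac{1}{t^2}\geq\int_{\mathbb{R}_+}\frac1x\,d\nu(x)+1+c-b$. Moreover, if $W_{(t,\lambda_0,\lambda_1,\ldots)}$ is CPD and $(b_t,c_t,\nu_t)$ is its scalar representing triplet, then $\nu(\{0\})=0$ and $$b_t=t^2(1-c)-1,\qquad c_t=t^2c,$$ $$\nu_t(\varDelta)=t^2\int_{\varDelta}\frac1x\,d\nu(x)+\nu_t(\{0\})\,\delta_0(\varDelta)\quad\text{for every Borel set }\varDelta\subseteq\mathbb{R}_+,$$ with $$\nu_t(\{0\})=1-t^2\Big(\int_{\mathbb{R}_+}\frac1x\,d\nu(x)+1+c-b\Big).$$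
   Context: $\mathbb{Z}_+=\{0,1,2,\dots\}$, $\mathbb{R}_+=[0,\infty)$; all measures are positive; $\delta_0$ is the probability measure concentrated at $0$. In integrals of $\frac1x$ the convention $\frac10=\infty$ is used. The polynomials $Q_n$ are $Q_0=Q_1=0$ and $Q_n(x)=\sum_{j=0}^{n-2}(n-j-1)x^j$ for $n\geq 2$. A real sequence $\{\gamma_n\}_{n=0}^\infty$ is CPD if $\sum_{i,j=0}^k \gamma_{i+j}\alpha_i\bar\alpha_j\geq 0$ for every finite sequence $\alpha_0,\dots,\alpha_k\in\mathbb{C}$ with $\sum_{j=0}^k\alpha_j=0$. A bounded operator $T$ on a complex Hilbert space $\mathcal{H}$ is CPD if $\{\|T^nh\|^2\}_{n=0}^\infty$ is CPD for every $h\in\mathcal{H}$. For a bounded sequence $\boldsymbol\lambda=\{\lambda_n\}_{n=0}^\infty$ of positive reals, $W_{\boldsymbol\lambda}$ is the bounded operator on $\ell^2$ with $W_{\boldsymbol\lambda}e_n=\lambda_ne_{n+1}$ ($\{e_n\}$ the standard orthonormal basis); $\hat\lambda_0=1$ and $\hat\lambda_n=\lambda_0^2\cdots\lambda_{n-1}^2$ for $n\geq1$. If $W_{\boldsymbol\lambda}$ is CPD, its scalar representing triplet is the unique $(b,c,\nu)$ with $b\in\mathbb{R}$, $c\in\mathbb{R}_+$, $\nu$ a compactly supported finite Borel measure on $\mathbb{R}_+$ with $\nu(\{1\})=0$ and $\hat\lambda_n=1+bn+cn^2+\int_{\mathbb{R}_+}Q_n\,d\nu$ for all $n\in\mathbb{Z}_+$.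 *)

(* Defs.v *)
From HB Require Import structures.
From mathcomp Require Import all_boot all_order all_algebra.
From mathcomp Require Import all_classical all_reals all_analysis.
From mathcomp Require Import complex lra.

Set Implicit Arguments.
Unset Strict Implicit.
Unset Printing Implicit Defensive.

Import Order.TTheory GRing.Theory Num.Theory.
Import numFieldNormedType.Exports.

Local Open Scope classical_set_scope.
Local Open Scope ring_scope.
Local Open Scope complex_scope.

Section Ell2.
Variable R : realType.

Notation normc := (@Normc.normc R).

(* The squared norm of an arbitrary complex sequence, possibly +oo. *)
Definition sqnorm (x : nat -> R[i]) : \bar R :=
  (\sum_(0 <= n <oo) (normc (x n) ^+ 2)%:E)%E.

Definition square_summable : {pred (nat -> R[i])} :=
  [pred x | `[< (sqnorm x < +oo)%E >]].

Lemma normc_ge0 (z : R[i]) : 0 <= normc z.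
Proof. by case: z => a b; rewrite /ComplexField.Normc.normc sqrtr_ge0. Qed.

Lemma sqnorm_ge0 (x : nat -> R[i]) : (0 <= sqnorm x)%E.
Proof. by apply: nneseries_ge0 => n _ _; rewrite lee_fin sqr_ge0. Qed.

Lemma square_summableP (x : nat -> R[i]) :
  reflect (sqnorm x < +oo)%E (x \in square_summable).
Proof. by apply: (iffP idP) => [/asboolP//|h]; exact/asboolP. Qed.

Lemma sqnorm_le (M : R) (x y : nat -> R[i]) :
  0 <= M -> (forall n, normc (y n) <= M * normc (x n)) ->
  (sqnorm y <= (M ^+ 2)%:E * sqnorm x)%E.
Proof.
move=> M0 xy; rewrite /sqnorm -nneseriesZl; last first.
  by move=> n _; rewrite lee_fin sqr_ge0.
apply: lee_nneseries => [n _ _|n _]; first by rewrite lee_fin sqr_ge0.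
rewrite -EFinM lee_fin -exprMn; apply: lerXn2r (xy n).
  by rewrite nnegrE normc_ge0.
by rewrite nnegrE mulr_ge0 ?normc_ge0.
Qed.

Lemma square_summable_submod_closed : submod_closed square_summable.
Proof.
split=> [|a x y /square_summableP xS /square_summableP yS].
  apply/square_summableP; rewrite /sqnorm eseries0 ?ltry// => n _ _.
  by rewrite /= expr0n /= addr0 sqrtr0 expr0n.
apply/square_summableP.
have le2 n : ((normc ((a *: x + y) n) ^+ 2)%:E <=
    (2 * normc a ^+ 2)%:E * (normc (x n) ^+ 2)%:E
     + 2%:E * (normc (y n) ^+ 2)%:E)%E.
  rewrite -!EFinM -EFinD lee_fin.
  have := le_normcD (a * x n) (y n); rewrite ComplexField.Normc.normcM => h.
  have h0 := normc_ge0 (a * x n + y n).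
  apply: (@le_trans _ _ ((normc a * normc (x n) + normc (y n)) ^+ 2)).
    by apply: lerXn2r h; rewrite nnegrE ?addr_ge0 ?mulr_ge0 ?normc_ge0.
  have := sqr_ge0 (normc a * normc (x n) - normc (y n)); nra.
apply: (@le_lt_trans _ _ ((2 * normc a ^+ 2)%:E * sqnorm x + 2%:E * sqnorm y)%E).
  rewrite /sqnorm -!nneseriesZl; do ?by move=> n _; rewrite lee_fin sqr_ge0.
  rewrite -nneseriesD; first last.
  - by move=> n _ _; rewrite -EFinM lee_fin mulr_ge0 ?sqr_ge0.
  - by move=> n _ _; rewrite -EFinM lee_fin -mulrA -exprMn mulr_ge0 ?sqr_ge0.
  apply: lee_nneseries => [n _ _|n _]; first by rewrite lee_fin sqr_ge0.
  exact: le2.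
by apply: lte_add_pinfty; apply: lte_mul_pinfty;
  rewrite // lee_fin ?mulr_ge0 ?normc_ge0 ?ler0n.
Qed.

HB.instance Definition _ := GRing.isSubmodClosed.Build R[i] (nat -> R[i])
  square_summable square_summable_submod_closed.

(* The complex Hilbert space l^2. *)
Record ell2 := Ell2 {
  ell2_val :> nat -> R[i];
  ell2_valP : ell2_val \in square_summable }.

HB.instance Definition _ := [isSub for ell2_val].
HB.instance Definition _ := [Choice of ell2 by <:].
HB.instance Definition _ := [SubChoice_isSubLmodule of ell2 by <:].

Definition ell2norm (x : ell2) : R := Num.sqrt (fine (sqnorm x)).

Lemma ell2_sqnormE (x : ell2) : sqnorm x = (ell2norm x ^+ 2)%:E.
Proof.
have /square_summableP x_fin := ell2_valP x.
rewrite /ell2norm sqr_sqrtr ?fine_ge0 ?sqnorm_ge0// fineK//.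
by rewrite ge0_fin_numE ?sqnorm_ge0.
Qed.

Definition delta_seq (k n : nat) : R[i] := (n == k)%:R.

Lemma delta_seq_square_summable k : delta_seq k \in square_summable.
Proof.
apply/square_summableP; rewrite /sqnorm (nneseriesD1 (n := k))//; last first.
  by move=> n _; rewrite lee_fin sqr_ge0.
rewrite eseries0 ?adde0 ?ltry// => n _ /= /negbTE nk.
by rewrite /delta_seq nk /= expr0n /= addr0 sqrtr0 expr0n.
Qed.

Definition ell2_basis (k : nat) : ell2 := Ell2 (delta_seq_square_summable k).

Definition bounded_operator (T : {linear ell2 -> ell2}) : Prop :=
  exists M : R, forall h, ell2norm (T h) <= M * ell2norm h.

End Ell2.

Section WeightedShift.
Variable R : realType.

Record weights := Weights {
  weight :> nat -> R;
  weight_gt0 : forall n, 0 < weight n;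
  weight_bounded : exists M : R, forall n, weight n <= M }.

Definition cons_seq (t : R) (lambda : nat -> R) (n : nat) : R :=
  if n is m.+1 then lambda m else t.

Lemma cons_seq_gt0 t (lambda : weights) : 0 < t ->
  forall n, 0 < cons_seq t lambda n.
Proof. by move=> t0 [|n] //=; exact: weight_gt0. Qed.

Lemma cons_seq_bounded t (lambda : weights) :
  exists M : R, forall n, cons_seq t lambda n <= M.
Proof.
have [M leM] := weight_bounded lambda.
by exists (Num.max t M) => -[|n] /=; rewrite le_max ?lexx ?leM ?orbT.
Qed.

Definition cons_weights (t : R) (t_gt0 : 0 < t) (lambda : weights) : weights :=
  Weights (cons_seq_gt0 lambda t_gt0) (cons_seq_bounded t lambda).

Definition shift_seq (lambda : nat -> R) (x : nat -> R[i]) (n : nat) : R[i] :=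
  if n is m.+1 then (lambda m)%:C * x m else 0.

Lemma sqnorm_shift_seq (lambda : nat -> R) x :
  sqnorm (shift_seq lambda x) = sqnorm (fun n => (lambda n)%:C * x n).
Proof.
rewrite /sqnorm nneseries_recl//; last by move=> n _; rewrite lee_fin sqr_ge0.
rewrite /= expr0n /= addr0 sqrtr0 expr0n add0e.
rewrite -(nneseries_addn (f := fun n => (_ (shift_seq lambda x n) ^+ 2)%:E) 1).
  by apply: eq_eseriesr => n _; rewrite addn1.
by move=> n; rewrite lee_fin sqr_ge0.
Qed.

Lemma shift_seq_le (lambda : weights) (M : R) x :
  (forall n, lambda n <= M) ->
  (sqnorm (shift_seq lambda x) <= (M ^+ 2)%:E * sqnorm x)%E.
Proof.
move=> leM; have M0 : 0 <= M by exact: le_trans (ltW (weight_gt0 lambda 0)) (leM 0).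
rewrite sqnorm_shift_seq; apply: sqnorm_le => // n.
rewrite ComplexField.Normc.normcM ler_wpM2r ?normc_ge0//=.
by rewrite expr0n /= addr0 sqrtr_sqr ger0_norm ?leM// ltW// weight_gt0.
Qed.

Lemma shift_seq_square_summable (lambda : weights) (x : ell2 R) :
  shift_seq lambda x \in @square_summable R.
Proof.
have [M leM] := weight_bounded lambda; apply/square_summableP.
apply: (le_lt_trans (shift_seq_le x leM)).
by rewrite ell2_sqnormE -EFinM ltry.
Qed.

Definition weighted_shift (lambda : weights) (x : ell2 R) : ell2 R :=
  Ell2 (shift_seq_square_summable lambda x).

Lemma weighted_shift_is_linear lambda : linear (weighted_shift lambda).
Proof.
move=> a x y; apply: val_inj; apply/funext => -[|n] /=.
  by rewrite -[RHS]/(a * 0 + 0) mulr0 addr0.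
rewrite -[LHS]/((lambda n)%:C * (a * x n + y n)).
by rewrite -[RHS]/(a * ((lambda n)%:C * x n) + (lambda n)%:C * y n) mulrDr mulrCA.
Qed.

HB.instance Definition _ lambda := GRing.isLinear.Build R[i] (ell2 R) (ell2 R)
  *:%R (weighted_shift lambda) (weighted_shift_is_linear lambda).

Lemma weighted_shift_bounded lambda : bounded_operator (weighted_shift lambda).
Proof.
have [M leM] := weight_bounded lambda; exists M => h.
have M0 : 0 <= M by exact: le_trans (ltW (weight_gt0 lambda 0)) (leM 0).
rewrite -(@ler_pXn2r _ 2) ?nnegrE ?mulr_ge0 ?sqrtr_ge0//.
by rewrite exprMn -lee_fin [leRHS]EFinM -!ell2_sqnormE; exact: shift_seq_le.
Qed.

Lemma weighted_shift_basis lambda n :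
  weighted_shift lambda (ell2_basis R n) =
  (lambda n)%:C *: ell2_basis R n.+1.
Proof.
apply: val_inj; apply/funext => -[|m] /=.
  by rewrite -[RHS]/((lambda n)%:C * 0) mulr0.
rewrite -[RHS]/((lambda n)%:C * (m.+1 == n.+1)%:R) /delta_seq eqSS.
by case: eqVneq => [->|_]; rewrite ?mulr0.
Qed.

End WeightedShift.

Section CPD.
Variable R : realType.

(* On R[i], 0 <= z means that z is real and nonnegative. *)
Definition cpd_seq (gamma : nat -> R) : Prop :=
  forall (k : nat) (alpha : 'I_k.+1 -> R[i]),
    \sum_(j < k.+1) alpha j = 0 ->
    0 <= \sum_(i < k.+1) \sum_(j < k.+1)
           (gamma (i + j)%N)%:C * alpha i * (alpha j)^*.

Definition cpd_operator (T : {linear ell2 R -> ell2 R}) : Prop :=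
  bounded_operator T /\
  forall h, cpd_seq (fun n => ell2norm (iter n T h) ^+ 2).

End CPD.

Section Triplet.
Variable R : realType.

Definition lambda_hat (lambda : nat -> R) (n : nat) : R :=
  \prod_(j < n) lambda j ^+ 2.

(* For n = 0 and n = 1 the bound n.-1 is 0, so that Qpoly n = 0. *)
Definition Qpoly (n : nat) : {poly R} := \poly_(j < n.-1) (n - j - 1)%:R.

(* A finite Borel measure on R_+ is encoded as a finite Borel measure on the
   real line that vanishes off some compact subset of R_+. *)
Definition scalar_triplet (lambda : weights R) (b c : R)
    (nu : {finite_measure set (measurableTypeR R) -> \bar R}) : Prop :=
  [/\ 0 <= c,
      exists K : set R, [/\ compact K, K `<=` `[0, +oo[ & nu (~` K) = 0],
      nu [set 1] = 0 &
      forall n : nat, (lambda_hat lambda n)%:E =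
        ((1 + b * n%:R + c * n%:R ^+ 2)%:E
         + \int[nu]_(x in `[0%R, +oo[) ((Qpoly n).[x])%:E)%E].

End Triplet.

(* Main.v *)
Require Import Defs.
From HB Require Import structures.
From mathcomp Require Import all_boot all_order all_algebra.
From mathcomp Require Import all_classical all_reals all_analysis.
From mathcomp Require Import measurable_realfun complex ring lra.

Set Implicit Arguments.
Unset Strict Implicit.
Unset Printing Implicit Defensive.

Import Order.TTheory GRing.Theory Num.Theory.
Import numFieldNormedType.Exports.

Local Open Scope classical_set_scope.
Local Open Scope ring_scope.

(** Write g_n for the moments of the shift (the squared norms of the n-th
    iterates of the first basis vector) and g'_n for those of the extension, so
    that g'_0 = 1 and g'_(n+1) = t^2 g_n.

    A polynomial p with p(1) = 0 is a multiple (X - 1) q, and multiplication by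
    (X - 1)^2 amounts to taking second differences of moments. Hence a sequence
    is conditionally positive definite exactly when its second difference is
    positive definite, i.e. nonnegative on squares q^2 of real polynomials
    ([cpd_seq_sqr_poly], [cpd_seq_of_sqr_poly]). For a sequence with triplet
    (b, c, nu) the second difference has the moments of nu + 2c delta_1
    ([triplet_riesz]). On the operator side, the orbit sequences of the extended
    shift are sums of orbit sequences of the original one and nonnegative
    multiples of g', so only g' has to be examined ([cpd_cons_shift]).

    Splitting q^2 = q(0)^2 + X s, the functional of the second difference of g'
    takes on q^2 the value
      q(0)^2 (1 + t^2 (b + c - 1)) + t^2 (int s dnu + 2 c s(1))
    ([riesz_cons]). As s(x) >= - q(0)^2 / x, the integral condition makes it
    nonnegative ([cpd_cons_sufficient]). Conversely the choice
    q = (1 - X / M)^n, with [0, M] carrying nu, makes - s increase to 1/x, and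
    the monotone convergence theorem turns nonnegativity into the integral
    condition ([cpd_cons_necessary]).

    If (bt, ct, nut) is a triplet of the extension, then
    x dnut + 2 ct delta_1 and t^2 (dnu + 2 c delta_1) have the same moments
    ([shift_moments]), so integrals of bounded pointwise limits of polynomials
    agree ([shift_bounded_limit]). The indicator of the point 1 is such a limit
    and gives ct ([triplet_shift_ct]). So is the indicator of x < a, by an
    explicit sequence of polynomials approaching a step ([step_cvg]), and its
    product with a truncated Neumann series of 1/x; letting the truncation tend
    to infinity identifies nut off 0 with t^2 / x dnu on half-lines, hence on all
    Borel sets ([triplet_shift_off0]). The remaining constants come from the
    first moments. *)

(** * Conditional positivity as positivity on squares of polynomials *)

Section Riesz.
Variable R : realType.
Implicit Types (g : nat -> R) (p q : {poly R}).

(** The linear functional on polynomials taking the n-th power of the variable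
    to g n: quadratic forms in a Hankel matrix become its values on products. *)
Definition riesz g p : R := \sum_(i < size p) p`_i * g i.

Lemma riesz_wide n g p : (size p <= n)%N -> riesz g p = \sum_(i < n) p`_i * g i.
Proof.
move=> pn; rewrite /riesz (big_ord_widen n (fun i => p`_i * g i) pn).
rewrite big_mkcond; apply: eq_bigr => i _; case: ltnP => // pi.
by rewrite nth_default ?mul0r.
Qed.

Lemma riesz_scalar g : scalar (riesz g).
Proof.
move=> a p q; pose n := maxn (size p) (size q).
have pn : (size p <= n)%N by rewrite leq_maxl.
have qn : (size q <= n)%N by rewrite leq_maxr.
rewrite (@riesz_wide n _ p)// (@riesz_wide n _ q)// (@riesz_wide n); last first.
  rewrite (leq_trans (size_polyD _ _))// geq_max qn andbT.
  exact: leq_trans (size_scale_leq _ _) pn.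
rewrite mulr_sumr -big_split/=; apply: eq_bigr => i _.
by rewrite coefD coefZ mulrDl mulrA.
Qed.

HB.instance Definition _ g := GRing.isLinear.Build R {poly R} R *%R (riesz g)
  (riesz_scalar g).

Lemma rieszXn g n : riesz g 'X^n = g n.
Proof.
rewrite /riesz size_polyXn big_ord_recr/= coefXn eqxx mul1r big1 ?add0r// => i _.
by rewrite coefXn (ltn_eqF (ltn_ord i)) mul0r.
Qed.

(** The device by which all identities between functionals below are reduced
    to monomials. *)
Lemma scalar_eq_riesz (L : {poly R} -> R) g : scalar L ->
  (forall n, L 'X^n = g n) -> L =1 riesz g.
Proof.
move=> Ls LX p.
have L0 : L 0 = 0 by have := Ls (-1) 0 0; rewrite scaler0 addr0 mulN1r addNr.
have LZ a u : L (a *: u) = a * L u by have := Ls a u 0; rewrite L0 !addr0.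
have LD : {morph L : u v / u + v} by move=> u v; rewrite -(scale1r u) Ls mul1r scale1r.
rewrite -[in LHS](coefK p) poly_def (big_morph L LD L0).
by apply: eq_bigr => i _; rewrite LZ LX.
Qed.

Lemma riesz_mul g p q m n : (size p <= m)%N -> (size q <= n)%N ->
  riesz g (p * q) = \sum_(i < m) \sum_(j < n) g (i + j)%N * p`_i * q`_j.
Proof.
move=> pm qn; rewrite -[in LHS](coefK p) -[in LHS](coefK q) !poly_def.
rewrite (big_ord_widen m (fun i => p`_i *: 'X^i) pm).
rewrite (big_ord_widen n (fun i => q`_i *: 'X^i) qn).
rewrite big_distrlr linear_sum/= big_mkcond; apply: eq_bigr => i _.
case: ltnP => [_|pi]; last first.
  by rewrite big1// => j _; rewrite [p`_i]nth_default// mulr0 mul0r.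
rewrite linear_sum/= big_mkcond; apply: eq_bigr => j _.
case: ltnP => [_|qj]; last by rewrite [q`_j]nth_default// mulr0.
rewrite -scalerAl -scalerAr -exprD !linearZ/= rieszXn; ring.
Qed.

Definition diff2 g n : R := g n.+2 - 2 * g n.+1 + g n.

(** Multiplication by (X - 1)^2 is the second difference on moments: this is
    what removes the constraint p(1) = 0 from conditional positivity, since
    such a p is a multiple of X - 1. *)
Lemma riesz_diff2 g q : riesz g (('X - 1%:P) ^+ 2 * q) = riesz (diff2 g) q.
Proof.
apply: (@scalar_eq_riesz (fun q => riesz g (('X - 1%:P) ^+ 2 * q))).
  by move=> a p r; rewrite mulrDr -scalerAr linearP.
move=> n; rewrite (_ : _ * _ = 'X^(n.+2) - 2 *: 'X^(n.+1) + 'X^n :> {poly R}).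
  by rewrite linearD linearB/= linearZ/= !rieszXn.
by rewrite scaler_nat !exprS; ring.
Qed.

Local Open Scope complex_scope.

(** As g is real and i + j is symmetric, the mixed terms of the hermitian form
    cancel, so complex coefficients bring no condition beyond the real ones. *)
Lemma cpd_form_real g k (a : 'I_k.+1 -> R[i]) :
  \sum_(i < k.+1) \sum_(j < k.+1) (g (i + j)%N)%:C * a i * (a j)^* =
  (\sum_(i < k.+1) \sum_(j < k.+1) g (i + j)%N * complex.Re (a i) * complex.Re (a j) +
   \sum_(i < k.+1) \sum_(j < k.+1) g (i + j)%N * complex.Im (a i) * complex.Im (a j))%:C.
Proof.
pose F (i j : 'I_k.+1) := g (i + j)%N * complex.Im (a i) * complex.Re (a j).
have swap : \sum_i \sum_j F i j = \sum_i \sum_j F j i by rewrite exchange_big.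
apply/eqP; rewrite eq_complex; apply/andP; split; apply/eqP.
  rewrite !raddf_sum /= -big_split/=; apply: eq_bigr => i _.
  rewrite !raddf_sum /= -big_split/=; apply: eq_bigr => j _.
  case: (a i) => x y; case: (a j) => z w /=; ring.
transitivity (\sum_i \sum_j F i j - \sum_i \sum_j F j i); last first.
  by rewrite swap subrr.
rewrite raddf_sum -sumrB/=; apply: eq_bigr => i _.
rewrite raddf_sum -sumrB/=; apply: eq_bigr => j _; rewrite /F addnC.
by case: (a i) => x y; case: (a j) => z w /=; ring.
Qed.

(** The polynomial (X - 1) q vanishes at 1, so the defining condition applies to
    its coefficients. With the converse below, conditional positivity of g is
    positivity of its second difference. *)
Lemma cpd_seq_sqr_poly g (q : {poly R}) : cpd_seq g -> 0 <= riesz (diff2 g) (q ^+ 2).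
Proof.
move=> cg; rewrite -riesz_diff2 -exprMn; set p := _ * q.
have p1 : p.[1] = 0 by rewrite /p hornerM !hornerE subrr mul0r.
have sp : (size p <= (size p).+1)%N by [].
pose a (i : 'I_(size p).+1) : R[i] := (p`_i)%:C.
have a0 : \sum_i a i = 0.
  rewrite -[RHS]/(0%:C) -p1 (horner_coef_wide _ sp) /a rmorph_sum/=.
  by apply: eq_bigr => i _; rewrite expr1n mulr1.
have := cg _ _ a0; rewrite cpd_form_real lecR expr2 (riesz_mul _ sp sp).
suff -> : \sum_(i < (size p).+1) \sum_(j < (size p).+1)
    g (i + j)%N * complex.Im (a i) * complex.Im (a j) = 0 by rewrite addr0.
by rewrite big1// => i _; rewrite big1// => j _; rewrite mulr0.
Qed.

Lemma cpd_seq_of_sqr_poly g :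
  (forall q : {poly R}, 0 <= riesz (diff2 g) (q ^+ 2)) -> cpd_seq g.
Proof.
move=> gq k a a0; rewrite cpd_form_real lecR.
have pos (r : 'I_k.+1 -> R) : \sum_i r i = 0 ->
    0 <= \sum_(i < k.+1) \sum_(j < k.+1) g (i + j)%N * r i * r j.
  move=> r0; pose p := \poly_(i < k.+1) r (inord i).
  have sp : (size p <= k.+1)%N by exact: size_poly.
  have pE (i : 'I_k.+1) : p`_i = r i by rewrite coef_poly ltn_ord inord_val.
  have p1 : root p 1.
    apply/rootP; rewrite (horner_coef_wide _ sp) -[RHS]r0.
    apply: eq_bigr => i _.
    by rewrite pE expr1n mulr1.
  have /factor_theorem[q pq] := p1.
  have := gq q; rewrite -riesz_diff2 -exprMn mulrC -pq expr2 (riesz_mul _ sp sp).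
  congr (_ <= _); apply: eq_bigr => i _; apply: eq_bigr => j _.
  by rewrite !pE.
by rewrite addr_ge0// pos// -raddf_sum a0.
Qed.

End Riesz.

(** * Reduction from the operator to its moment sequence *)

Section Operators.
Variable R : realType.
Implicit Types (g : nat -> R) (lambda : weights R).
Local Open Scope complex_scope.

Notation normc := (@Normc.normc R).

Lemma cpd_seq_comb (s : R) g1 g2 : 0 <= s -> cpd_seq g1 -> cpd_seq g2 ->
  cpd_seq (fun n => s * g1 n + g2 n).
Proof.
move=> s0 cg1 cg2; apply: cpd_seq_of_sqr_poly => q.
suff -> : riesz (diff2 (fun n => s * g1 n + g2 n)) (q ^+ 2) =
    s * riesz (diff2 g1) (q ^+ 2) + riesz (diff2 g2) (q ^+ 2).
  by rewrite addr_ge0 ?mulr_ge0// cpd_seq_sqr_poly.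
rewrite /riesz mulr_sumr -big_split/=; apply: eq_bigr => i _.
by rewrite /diff2; ring.
Qed.

(** The powers of a weighted shift map basis vectors to multiples of distinct
    basis vectors, hence squared norms add up coordinatewise. *)
Lemma sqnorm_iter_shift lambda n (h : ell2 R) :
  sqnorm (iter n (weighted_shift lambda) h) =
  (\sum_(0 <= m <oo)
     ((\prod_(j < n) lambda (m + j)%N) ^+ 2 * normc (h m) ^+ 2)%:E)%E.
Proof.
elim: n h => [|n IH] h.
  by apply: eq_eseriesr => m _; rewrite big_ord0 expr1n mul1r.
rewrite iterSr IH nneseries_recl//; last first.
  by move=> m _; rewrite lee_fin mulr_ge0// sqr_ge0.
rewrite /= expr0n /= addr0 sqrtr0 expr0n mulr0 add0e.
rewrite -(nneseries_addn (f := fun m => (_ * normc (shift_seq lambda h m) ^+ 2)%:E) 1).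
  apply: eq_eseriesr => m _; rewrite addn1 big_ord_recl addn0/=.
  rewrite Normc.normcM exprMn mulrA -exprMn/= expr0n/= addr0.
  rewrite sqrtr_sqr exprMn real_normK ?num_real// -exprMn; congr ((_ ^+ _ * _)%:E).
  by rewrite mulrC; congr (_ * _); apply: eq_bigr => j _; rewrite addSnnS.
by move=> m; rewrite lee_fin mulr_ge0// sqr_ge0.
Qed.

Lemma lambda_hat_iter lambda n :
  ell2norm (iter n (weighted_shift lambda) (ell2_basis R 0)) ^+ 2 =
  lambda_hat lambda n.
Proof.
apply: EFin_inj; rewrite -ell2_sqnormE sqnorm_iter_shift nneseries_recl//.
  rewrite eseries0 ?adde0//= => [|m].
    by rewrite expr0n/= addr0 expr1n sqrtr1 expr1n mulr1 -prodrXl.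
  by case: m => // m _ _; rewrite /= expr0n/= addr0 sqrtr0 expr0n mulr0.
by move=> m _; rewrite lee_fin mulr_ge0// sqr_ge0.
Qed.

Lemma lambda_hat_cons (t : R) (lambda : nat -> R) n :
  lambda_hat (cons_seq t lambda) n =
  if n is m.+1 then t ^+ 2 * lambda_hat lambda m else 1.
Proof. by case: n => [|n]; rewrite /lambda_hat ?big_ord0// big_ord_recl. Qed.

Lemma tail_square_summable (h : ell2 R) :
  (fun n => h n.+1) \in @square_summable R.
Proof.
have /square_summableP := ell2_valP h; rewrite /sqnorm nneseries_recl//; last first.
  by move=> m _; rewrite lee_fin sqr_ge0.
move=> hlt; apply/square_summableP; apply: le_lt_trans hlt.
rewrite -[leLHS]add0e leeD//; first by rewrite lee_fin sqr_ge0.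
rewrite -(nneseries_addn (f := fun m => (normc (h m) ^+ 2)%:E) 1).
  by rewrite le_eqVlt/sqnorm; apply/orP; left; apply/eqP/eq_eseriesr => m _; rewrite addn1.
by move=> m; rewrite lee_fin sqr_ge0.
Qed.

(** The coordinates of h other than the 0-th live in the subspace on which the
    extended shift is unitarily equivalent to the original one. *)
Lemma sqnorm_iter_cons lambda (t : R) (t0 : 0 < t) (h : ell2 R) n :
  ell2norm (iter n (weighted_shift (cons_weights t0 lambda)) h) ^+ 2 =
  normc (h 0%N) ^+ 2 * lambda_hat (cons_seq t lambda) n +
  ell2norm (iter n (weighted_shift lambda) (Ell2 (tail_square_summable h))) ^+ 2.
Proof.
apply: EFin_inj; rewrite EFinD -!ell2_sqnormE !sqnorm_iter_shift nneseries_recl//.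
  rewrite mulrC -prodrXl; congr (_ + _)%E.
  rewrite -(nneseries_addn (f := fun m => ((\prod_(j < n) cons_seq t lambda (m + j)) ^+ 2
    * normc (h m) ^+ 2)%:E) 1).
    by apply: eq_eseriesr => m _; rewrite addn1.
  by move=> m; rewrite lee_fin mulr_ge0// sqr_ge0.
by move=> m _; rewrite lee_fin mulr_ge0// sqr_ge0.
Qed.

(** By the splitting above, the orbit sequence of any h is a nonnegative
    multiple of the orbit sequence of the first basis vector plus an orbit
    sequence of the original shift. *)
Lemma cpd_cons_shift lambda (t : R) (t0 : 0 < t) :
  cpd_operator (weighted_shift lambda) ->
  cpd_operator (weighted_shift (cons_weights t0 lambda)) <->
  cpd_seq (lambda_hat (cons_seq t lambda)).
Proof.
move=> [_ cpdW]; split=> [[_ /(_ (ell2_basis R 0))]|cpdt].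
  congr (cpd_seq _); apply/funext => n; exact: lambda_hat_iter.
split=> [|h]; first exact: weighted_shift_bounded.
have cpdh := cpd_seq_comb (sqr_ge0 (normc (h 0%N))) cpdt
  (cpdW (Ell2 (tail_square_summable h))).
rewrite -[X in cpd_seq X]/(fun n =>
  ell2norm (iter n (weighted_shift (cons_weights t0 lambda)) h) ^+ 2).
by rewrite (funext (sqnorm_iter_cons lambda t0 h)).
Qed.

End Operators.

(** * Representing triplets and second differences *)

Section ShiftedTriplet.
Variable R : realType.
Implicit Types (lambda : weights R) (M : R) (p q : {poly R}).
Implicit Types (nu : {finite_measure set (measurableTypeR R) -> \bar R}).

Lemma poly_integrable nu M p :
  nu.-integrable `[0, M] (EFin \o (fun x => p.[x])).
Proof.
apply: measurable_bounded_integrable => //; first by rewrite ltey_eq fin_num_measure.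
  by apply: measurable_funTS; exact: (continuous_measurable_fun (@continuous_horner R p)).
have /compact_bounded[C [Creal bd]] : compact ((horner p : R -> R) @` (`[0, M] : set R)).
  apply: continuous_compact; last exact: segment_compact.
  exact: (continuous_subspaceT (@continuous_horner R p)).
by exists C; split=> // N CN x Ix; apply: (bd N CN); exists x.
Qed.

(** Over a bounded interval every polynomial is integrable, so that the
    integral is a real-valued linear functional. *)
Definition pint nu M p : R := \int[nu]_(x in `[0, M]) p.[x].

Lemma pint_scalar nu M : scalar (pint nu M).
Proof.
move=> a p q; rewrite /pint -RintegralZl//; last exact: poly_integrable.
rewrite -RintegralD//.
- by apply: eq_Rintegral => x _; rewrite hornerD hornerZ.
- by have := poly_integrable nu M (a *: p);
    under [X in _.-integrable _ X]eq_fun do rewrite /= hornerZ.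
- exact: poly_integrable.
Qed.

HB.instance Definition _ nu M := GRing.isLinear.Build R {poly R} R *%R (pint nu M)
  (@pint_scalar nu M).

Lemma EFin_pint nu M p :
  (pint nu M p)%:E = (\int[nu]_(x in `[0%R, M]) (p.[x])%:E)%E.
Proof. by rewrite /pint/Rintegral fineK// integrable_fin_num//; exact: poly_integrable. Qed.

Lemma Qpoly_coef n j : (Qpoly R n)`_j = (n - j - 1)%:R.
Proof.
rewrite coef_poly; case: ltnP => // nj.
by rewrite -subnDA addn1 (eqP (_ : (n - j.+1 == 0)%N))// subn_eq0 -ltnS;
  case: n nj.
Qed.

(** The polynomials Q_n are the solution of this recurrence with
    Q_0 = Q_1 = 0; it is the reason why they appear in the representation. *)
Lemma Qpoly_diff2 n : Qpoly R n.+2 - 2 *: Qpoly R n.+1 + Qpoly R n = 'X^n.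
Proof.
apply/polyP => j; rewrite coefD coefB coefZ !Qpoly_coef coefXn.
rewrite -!subnDA !addn1 !subSS.
case: (ltngtP j n) => [jn|nj|->].
- rewrite subSn ?(ltnW jn)// -(subnSK jn).
  by rewrite -(natr1 (n - j.+1).+1) -(natr1 (n - j.+1)) mulr0n; ring.
- rewrite (eqP (_ : (n.+1 - j == 0)%N)) ?subn_eq0//.
  rewrite (eqP (_ : (n - j == 0)%N)) ?subn_eq0 1?ltnW//.
  by rewrite (eqP (_ : (n - j.+1 == 0)%N)) ?subn_eq0 1?ltnW 1?ltnW// !mulr0n; ring.
- by rewrite subSnn subnn (eqP (_ : (n - n.+1 == 0)%N)) ?subn_eq0// mulr0n mulr1n; ring.
Qed.

Definition supported nu M := nu (~` `[0, M]) = 0%E.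

(** A common bound for finitely many compact supports is then available from
    the filter at infinity. *)
Lemma triplet_supported lambda b c nu : scalar_triplet lambda b c nu ->
  \forall M \near +oo, supported nu M.
Proof.
case=> _ [K [cK K0 nuK]] _ _.
have [C [Creal KC]] := compact_bounded cK.
exists C; split=> // M /KC KM.
apply: (subset_measure0 _ _ _ nuK).
- by apply: measurableC; exact: measurable_itv.
- by apply: measurableC; exact: compact_measurable.
- apply: subsetC => x Kx /=; have /= := K0 _ Kx; rewrite !in_itv/= andbT => x0.
  by rewrite x0/= (le_trans (ler_norm _))// KM.
Qed.

Lemma supported_integral nu M (D : set R) (f : R -> \bar R) : supported nu M ->
  measurable D -> measurable_fun D f -> (forall x, D x -> 0 <= f x)%E ->
  (\int[nu]_(x in D) f x = \int[nu]_(x in D `&` `[0%R, M]) f x)%E.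
Proof.
move=> nuM mD mf f0.
rewrite (@ge0_negligible_integral _ _ _ nu D (~` `[0, M]) f)// ?setDE ?setCK//.
exact: measurableC.
Qed.

Lemma Qpoly_ge0 n (x : R) : 0 <= x -> 0 <= (Qpoly R n).[x].
Proof.
by move=> x0; rewrite horner_coef sumr_ge0// => i _; rewrite Qpoly_coef mulr_ge0 ?exprn_ge0.
Qed.

Lemma triplet_lambda_hat lambda b c nu M : supported nu M ->
  scalar_triplet lambda b c nu -> forall n,
  lambda_hat lambda n = 1 + b * n%:R + c * n%:R ^+ 2 + pint nu M (Qpoly R n).
Proof.
move=> nuM [_ _ _ lE] n; apply: EFin_inj.
rewrite lE [RHS]EFinD; congr (_ + _)%E.
rewrite (supported_integral nuM)//.
- rewrite EFin_pint; congr (integral _ _ _).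
  by rewrite setIidr// => x /=; rewrite !in_itv/= andbT => /andP[].
- apply/measurable_EFinP; apply: measurable_funTS.
  by exact: (continuous_measurable_fun (@continuous_horner R _)).
- by move=> x /=; rewrite in_itv/= andbT lee_fin; exact: Qpoly_ge0.
Qed.

(** The drift b disappears in second differences, the quadratic term becomes a
    mass 2c at the point 1, and nu becomes an ordinary representing measure. *)
Lemma triplet_riesz lambda b c nu M : supported nu M ->
  scalar_triplet lambda b c nu -> forall p,
  riesz (diff2 (lambda_hat lambda)) p = pint nu M p + 2 * c * p.[1].
Proof.
move=> nuM tri p; symmetry.
apply: (@scalar_eq_riesz _ (fun p => pint nu M p + 2 * c * p.[1])) => [a u v|n].
  by rewrite pint_scalar hornerD hornerZ; ring.
rewrite /diff2 !(triplet_lambda_hat nuM tri) hornerXn expr1n -Qpoly_diff2.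
rewrite linearD linearB linearZ/= -(natr1 n.+1) -(natr1 n); ring.
Qed.

(** Partial sums of the Neumann series of 1/x = M^-1 / (1 - (1 - x / M)). On
    [0, M] they are nonnegative and increase to 1/x, including the value +oo at
    0, so monotone convergence applies to them. *)
Definition invpoly M m : {poly R} := M^-1 *: \sum_(j < m) (1 - M^-1 *: 'X) ^+ j.

Lemma mulX_invpoly M m : M != 0 ->
  'X * invpoly M m = 1 - (1 - M^-1 *: 'X) ^+ m.
Proof.
move=> M0; rewrite /invpoly -scalerAr scalerAl -[RHS]opprB subrX1 -mulNr.
by congr (_ * _); ring.
Qed.

Lemma invpolyE M m x : M != 0 ->
  x * (invpoly M m).[x] = 1 - (1 - x / M) ^+ m.
Proof.
move=> M0; have := congr1 (horner^~ x) (mulX_invpoly m M0).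
by rewrite [x / M]mulrC /= hornerM hornerX !hornerE.
Qed.

Lemma invpoly_horner M m x :
  (invpoly M m).[x] = M^-1 * \sum_(j < m) (1 - x / M) ^+ j.
Proof.
rewrite /invpoly hornerZ horner_sum; congr (_ * _); apply: eq_bigr => j _.
by rewrite !hornerE (mulrC M^-1).
Qed.

Lemma invpoly_ge0 M m x : x \in `[0, M] -> 0 <= (invpoly M m).[x].
Proof.
rewrite in_itv/= => /andP[x0 xM]; have M0 := le_trans x0 xM.
rewrite invpoly_horner mulr_ge0 ?invr_ge0// sumr_ge0// => j _; rewrite exprn_ge0//.
rewrite subr_ge0; have [->|Mn0] := eqVneq M 0; first by rewrite invr0 mulr0.
by rewrite ler_pdivrMr ?mul1r// lt_neqAle eq_sym Mn0.
Qed.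

Lemma invpoly_nd M x : x \in `[0, M] ->
  nondecreasing_seq (fun m => (invpoly M m).[x]).
Proof.
rewrite in_itv/= => /andP[x0 xM]; have M0 := le_trans x0 xM.
apply/nondecreasing_seqP => m; rewrite !invpoly_horner ler_wpM2l ?invr_ge0//.
rewrite big_ord_recr/= lerDl exprn_ge0//.
rewrite subr_ge0; have [->|Mn0] := eqVneq M 0; first by rewrite invr0 mulr0.
by rewrite ler_pdivrMr ?mul1r// lt_neqAle eq_sym Mn0.
Qed.

Lemma invpoly_cvg M x : 0 < M -> x \in `[0, M] ->
  (((invpoly M m).[x])%:E @[m --> \oo] --> (x%:E)^-1)%E.
Proof.
move=> M0; rewrite in_itv/= => /andP[x0 xM].
have Mn0 : M != 0 by rewrite gt_eqF.
rewrite inver; have [->|xn0] := eqVneq x 0.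
  rewrite (_ : (fun m => _) = fun m => (M^-1 * m%:R)%:E); last first.
    apply/funext => m; rewrite invpoly_horner mul0r subr0.
    by under eq_bigr do rewrite expr1n; rewrite sumr_const card_ord.
  have Mi : 0 < M^-1 by rewrite invr_gt0.
  by apply/cvgeryP; apply: cvg_comp (@cvgr_idn R) (gt0_cvgMry Mi cvg_id).
have xgt0 : 0 < x by rewrite lt_neqAle eq_sym xn0.
apply/cvg_EFin; first exact: nearW.
rewrite (_ : _ \o _ = fun m => (1 - (1 - x / M) ^+ m) * x^-1); last first.
  by apply/funext => m /=; rewrite -(invpolyE _ _ Mn0) mulrC mulKf.
rewrite -[X in _ --> X]mul1r; apply: cvgMl; rewrite -[X in _ --> X]subr0.
apply: cvgB; first exact: cvg_cst.
apply: cvg_expr; rewrite ger0_norm ?subr_ge0 ?ler_pdivrMr ?mul1r//.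
by rewrite ltrBlDr ltrDl divr_gt0.
Qed.

End ShiftedTriplet.

(** * The criterion for a one-step backward extension *)

Section BackwardExtension.
Variable R : realType.
Implicit Types (lambda : weights R) (M t : R) (p q s : {poly R}).
Implicit Types (nu : {finite_measure set (measurableTypeR R) -> \bar R}).

Lemma measurable_inve : measurable_fun [set: R] (fun x : R => (x%:E)^-1 : \bar R)%E.
Proof.
pose D : set R := [set x | x != 0].
have mV : measurable_fun D (fun x : R => x^-1).
  apply: open_continuous_measurable_fun; first exact: open_neq.
  by move=> x; rewrite inE; exact: inv_continuous.
have DT : [set: R] = D `|` [set 0].
  by apply/seteqP; split=> // x _; case: (eqVneq x 0) => [->|x0]; [right|left].
rewrite DT; apply/measurable_funU => //.
  by apply: open_measurable; exact: open_neq.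
split; last exact: measurable_fun_set1.
apply: (eq_measurable_fun (fun x : R => (x^-1)%:E)).
  by move=> x; rewrite inE => /= x0; rewrite inver (negbTE x0).
exact/measurable_EFinP.
Qed.

Lemma ge0_inve (x : R) : 0 <= x -> (0 <= (x%:E)^-1 :> \bar R)%E.
Proof. by move=> x0; rewrite inver; case: eqP => // _; rewrite lee_fin invr_ge0. Qed.

Lemma integral_inve_supported nu M : supported nu M ->
  (\int[nu]_(x in `[0%R, +oo[) (x%:E)^-1 = \int[nu]_(x in `[0%R, M]) (x%:E)^-1)%E.
Proof.
move=> nuM; rewrite (supported_integral nuM)//.
- congr (integral _ _ _).
  by rewrite setIidr// => x /=; rewrite !in_itv/= andbT => /andP[].
- by apply: measurable_funTS; exact: measurable_inve.
- by move=> x /=; rewrite in_itv/= andbT; exact: ge0_inve.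
Qed.

Lemma diff2_consS t lambda n :
  diff2 (lambda_hat (cons_seq t lambda)) n.+1 = t ^+ 2 * diff2 (lambda_hat lambda) n.
Proof. by rewrite /diff2 !lambda_hat_cons; ring. Qed.

Lemma invpoly_integral_cvg nu M (D : set R) : 0 < M -> measurable D ->
  D `<=` `[0, M] ->
  (\int[nu]_(x in D) ((invpoly M m).[x])%:E @[m --> \oo] -->
   \int[nu]_(x in D) (x%:E)^-1)%E.
Proof.
move=> M0 mD DM.
rewrite (_ : (\int[nu]_(x in D) (x%:E)^-1 =
  \int[nu]_(x in D) limn (fun m => ((invpoly M m).[x])%:E))%E); last first.
  apply: eq_integral => x /[!inE] xD; apply/esym/cvg_lim => //.
  exact: invpoly_cvg M0 (DM _ xD).
apply: cvg_monotone_convergence => //.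
- move=> m; apply/measurable_EFinP; apply: measurable_funTS.
  exact: (continuous_measurable_fun (@continuous_horner R _)).
- by move=> m x xD; rewrite lee_fin; exact: invpoly_ge0 (DM _ xD).
- by move=> x xD m n mn; rewrite lee_fin; exact: invpoly_nd (DM _ xD) _ _ mn.
Qed.

Section OneStep.
Variables (lambda : weights R) (b c t M : R).
Variable nu : {finite_measure set (measurableTypeR R) -> \bar R}.
Hypotheses (M1 : 1 < M) (nuM : supported nu M).
Hypothesis tri : scalar_triplet lambda b c nu.

(** Prepending t replaces every second difference but the first by t^2 times
    the preceding one; a polynomial is split accordingly at its constant
    coefficient. *)
Lemma riesz_cons a s :
  riesz (diff2 (lambda_hat (cons_seq t lambda))) (a%:P + 'X * s) =
  a * (1 + t ^+ 2 * (b + c - 1)) + t ^+ 2 * (pint nu M s + 2 * c * s.[1]).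
Proof.
rewrite linearD/=; congr (_ + _).
  rewrite -alg_polyC linearZ/= -(expr0 'X) rieszXn; congr (_ * _).
  rewrite /diff2 !lambda_hat_cons (triplet_lambda_hat nuM tri 1).
  rewrite /Qpoly poly_def big_ord0 linear0 /lambda_hat big_ord0; ring.
rewrite -(triplet_riesz nuM tri) /riesz.
have sX : (size ('X * s)%R <= (size s).+1)%N.
  by rewrite (leq_trans (size_polyMleq _ _))// size_polyX.
rewrite -[LHS]/(riesz _ _) (riesz_wide _ sX) big_ord_recl coefXM mul0r add0r.
rewrite mulr_sumr; apply: eq_bigr => i _.
by rewrite coefXM /= diff2_consS; ring.
Qed.

(** Positivity is tested on the square of q = (1 - X / M)^n. Since
    q^2 = 1 - X u with u a truncated Neumann series, it gives
    t^2 (int u dnu + 2 c u(1)) <= 1 + t^2 (b + c - 1); as n grows, u increases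
    to 1/x and u(1) tends to 1. *)
Lemma cpd_cons_necessary : 0 < t ->
  cpd_seq (lambda_hat (cons_seq t lambda)) ->
  (\int[nu]_(x in `[0%R, +oo[) (x%:E)^-1 + (1 + c - b)%:E <= ((t ^+ 2)^-1)%:E)%E.
Proof.
move=> t0 ct; have M0 : 0 < M by exact: lt_trans M1.
have Mn0 : M != 0 by rewrite gt_eqF.
have t2 : 0 < t ^+ 2 by rewrite exprn_gt0.
pose z := (1 - 1 / M) ^+ 2.
have bound n : pint nu M (invpoly M (n * 2)) <=
    (t ^+ 2)^-1 + b - c - 1 + 2 * c * z ^+ n.
  have := cpd_seq_sqr_poly ((1 - M^-1 *: 'X) ^+ n) ct.
  have -> : ((1 - M^-1 *: 'X) ^+ n) ^+ 2 = 1%:P + 'X * (- invpoly M (n * 2)).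
    by rewrite mulrN mulX_invpoly// polyC1 exprM opprB [RHS]addrC subrK.
  rewrite riesz_cons linearN/= hornerN -[(invpoly _ _).[1]]mul1r invpolyE//.
  rewrite [(_ ^+ (n * 2))]exprM exprAC -/z => h.
  rewrite -(ler_pM2l t2) !mulrDr divff ?gt_eqF//; nra.
rewrite -leeBrDr// -EFinB.
have z01 : `|z| < 1.
  have M0' : 0 < M^-1 by rewrite invr_gt0.
  have M1' : M^-1 < 1 by rewrite invf_lt1.
  by rewrite ger0_norm ?sqr_ge0// /z div1r; nra.
have cvl : ((pint nu M (invpoly M (n * 2)))%:E @[n --> \oo] -->
    \int[nu]_(x in `[0%R, +oo[) (x%:E)^-1)%E.
  have cv : ((pint nu M (invpoly M m))%:E @[m --> \oo] -->
      \int[nu]_(x in `[0%R, +oo[) (x%:E)^-1)%E.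
    rewrite (integral_inve_supported nuM); under eq_cvg do rewrite EFin_pint.
    exact: invpoly_integral_cvg.
  by apply: cvg_comp cv; exact: (@cvg_mulnr 2).
have cvr : (((t ^+ 2)^-1 + b - c - 1 + 2 * c * z ^+ n)%:E @[n --> \oo] -->
   ((t ^+ 2)^-1 - (1 + c - b))%:E)%E.
  apply: cvg_EFin; first exact: nearW.
  rewrite (_ : _ - (_ - _) = (t ^+ 2)^-1 + b - c - 1 + 2 * c * 0); last by ring.
  apply: cvgD; first exact: cvg_cst.
  by apply: cvgMr; exact: cvg_expr.
by apply: lee_cvg_to cvl cvr _; apply: nearW => n; rewrite lee_fin.
Qed.

(** For q^2 = a + X s with a = q(0)^2 one has
    s(x) = (q(x)^2 - a) / x >= - a / x. Integrating, and using s(1) >= - a for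
    the mass at 1, the functional is at least t^2 a times the slack in the
    inequality. *)
Lemma cpd_cons_sufficient : 0 < t -> 0 <= c ->
  (\int[nu]_(x in `[0%R, +oo[) (x%:E)^-1 + (1 + c - b)%:E <= ((t ^+ 2)^-1)%:E)%E ->
  cpd_seq (lambda_hat (cons_seq t lambda)).
Proof.
move=> t0 c0 + ; rewrite (integral_inve_supported nuM) => Jle.
have t2 : 0 < t ^+ 2 by rewrite exprn_gt0.
have J0 : (0 <= \int[nu]_(x in `[0%R, M]) (x%:E)^-1)%E.
  by apply: integral_ge0 => x /=; rewrite in_itv/= => /andP[x0 _]; exact: ge0_inve.
have mJ : measurable_fun `[0, M] (fun x : R => (x%:E)^-1 : \bar R)%E.
  by apply: measurable_funTS; exact: measurable_inve.
have Joo : (\int[nu]_(x in `[0%R, M]) (x%:E)^-1 < +oo)%E.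
  move: Jle; rewrite -leeBrDr// => /le_lt_trans; apply; exact: ltry.
have [J JE] : exists J : R, (\int[nu]_(x in `[0%R, M]) (x%:E)^-1 = J%:E)%E.
  by exists (fine (\int[nu]_(x in `[0%R, M]) (x%:E)^-1)%E); rewrite fineK// ge0_fin_numE.
move: Jle; rewrite JE -EFinD lee_fin => Jle.
apply: cpd_seq_of_sqr_poly => q; set a := q.[0] ^+ 2.
have : root (q ^+ 2 - a%:P) 0 by rewrite /root !hornerE subrr.
move=> /factor_theorem[s /eqP]; rewrite subr0 subr_eq addrC mulrC => /eqP qE.
have sE x : x * s.[x] = q.[x] ^+ 2 - a.
  by have := congr1 (horner^~ x) qE; rewrite /= !hornerE => ->; ring.
have a0 : 0 <= a by rewrite sqr_ge0.
have ps : - pint nu M s <= a * J.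
  rewrite -[- _]linearN -lee_fin EFin_pint EFinM -JE.
  rewrite -ge0_integralZl//; last first.
    by move=> x /=; rewrite in_itv/= => /andP[x0 _]; exact: ge0_inve.
  have iJ : nu.-integrable `[0, M] (fun x : R => (x%:E)^-1)%E.
    apply/integrableP; split=> //.
    rewrite (_ : integral _ _ _ = J%:E) ?ltry// -JE; apply: eq_integral => x.
    by rewrite inE/= in_itv/= => /andP[x0 _]; rewrite gee0_abs ?ge0_inve.
  apply: le_integral => //.
  - exact: (poly_integrable nu M (- s)).
  - exact: integrableZl.
  move=> x; rewrite inE/= in_itv/= => /andP[x0 _]; rewrite hornerN inver.
  case: eqP => [->|/eqP xn0]; last first.
    rewrite -EFinM lee_fin ler_pdivlMr ?lt_neqAle 1?eq_sym ?xn0// mulNr mulrC sE.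
    have := sqr_ge0 q.[x]; lra.
  (* At x = 0 the right-hand side is a * +oo, which is 0 when a = 0; then
     q(0) = 0 and s(0), the linear coefficient of q^2, vanishes. *)
  have [a_0|an0] := eqVneq a 0; last first.
    by rewrite gt0_muley ?leey// lte_fin lt_neqAle eq_sym an0.
  have q0 : q.[0] = 0 by apply/eqP; rewrite -sqrf_eq0 -/a a_0.
  have : (q ^+ 2)`_1 = s.[0].
    by rewrite qE coefD coefC coefXM /= add0r horner_coef0.
  rewrite expr2 coefM !big_ord_recl big_ord0 /= /bump/= addn0 subnn -horner_coef0 q0.
  by rewrite !(mul0r, mulr0, addr0) => <-; rewrite a_0 mul0e oppr0.
rewrite qE riesz_cons.
have s1 : - s.[1] <= a by have := sE 1; have := sqr_ge0 q.[1]; rewrite mul1r; lra.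
have k : 0 <= 1 - t ^+ 2 * (J + (1 + c - b)).
  by rewrite subr_ge0 -ler_pdivlMl// mulr1.
have := mulr_ge0 a0 k.
have := mulr_ge0 (ltW t2) (_ : 0 <= a * J + pint nu M s).
have := mulr_ge0 (mulr_ge0 (ltW t2) c0) (_ : 0 <= a + s.[1]).
move=> /(_ _)h1 /(_ _) h2.
have h1' := h1 ltac:(lra). have h2' := h2 ltac:(lra).
nra.
Qed.

End OneStep.
End BackwardExtension.

(** * Polynomial approximation of a step, and densities *)

Section Steps.
Variable R : realType.

Lemma bernoulli_le (x : R) n : -1 <= x -> 1 + n%:R * x <= (1 + x) ^+ n.
Proof.
move=> x1; elim: n => [|n IH]; first by rewrite mul0r addr0 expr0.
have h : 0 <= 1 + x by lra.
rewrite exprS -natr1; have := ler_wpM2l h IH.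
have := sqr_ge0 x; have : 0 <= n%:R :> R by [].
nra.
Qed.

(** With w the square root of z, (n + 1) w^n is at most the geometric sum
    1 + w + ... + w^n, hence bounded, and z^n = w^n w^n. *)
Lemma cvg_natSMexp (z : R) : 0 <= z -> z < 1 ->
  n.+1%:R * z ^+ n @[n --> \oo] --> 0.
Proof.
move=> z0 z1; pose w := Num.sqrt z.
have w0 : 0 <= w by exact: sqrtr_ge0.
have zE : z = w ^+ 2 by rewrite sqr_sqrtr.
have w1 : w < 1 by rewrite -(@ltr_pXn2r _ 2) ?nnegrE// -zE expr1n.
have w2 : 0 < 1 - w by rewrite subr_gt0.
apply: (@squeeze_cvgr _ _ _ _ (fun=> 0) (fun n => (1 - w)^-1 * w ^+ n)).
- apply: nearW => n; rewrite mulr_ge0 ?exprn_ge0//= zE exprAC expr2 mulrA.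
  rewrite ler_wpM2r ?exprn_ge0// -(ler_pM2l w2) mulfV ?gt_eqF//.
  have := subrX1 w n.+1.
  have : n.+1%:R * w ^+ n <= \sum_(j < n.+1) w ^+ j.
    rewrite mulr_natl -[n.+1 in leLHS]card_ord -sumr_const; apply: ler_sum => j _.
    by apply: ler_wiXn2l => //; [exact: ltW|rewrite -ltnS].
  move=> /(ler_wpM2l (ltW w2)); have := exprn_ge0 n.+1 w0; nra.
- exact: cvg_cst.
- rewrite -[X in _ --> X](mulr0 (1 - w)^-1); apply: cvgMr.
  by apply: cvg_expr; rewrite ger0_norm.
Qed.

(** By Bernoulli's inequality the left side is at least 1 - (n + 1) (k y)^n;
    multiplied by (1 + y^n) to the same exponent, which is at least
    1 + (n + 1) (k y)^n, it is at most 1. The exponent is (n + 1) k^n rather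
    than k^n to have the limit 0 also at the jump y = 1/k. *)
Lemma step_cvg (k : nat) (y : R) : 0 <= y -> y <= 1 ->
  (1 - y ^+ n) ^+ (n.+1 * k ^ n) @[n --> \oo] --> ((k%:R * y < 1)%R%:R : R).
Proof.
move=> y0 y1.
have yn0 n : 0 <= y ^+ n by rewrite exprn_ge0.
have yn1 n : y ^+ n <= 1 by rewrite exprn_ile1.
have NE n : (n.+1 * k ^ n)%:R * y ^+ n = n.+1%:R * (k%:R * y) ^+ n.
  by rewrite natrM natrX exprMn mulrA.
have s0 n : 0 <= (1 - y ^+ n) ^+ (n.+1 * k ^ n) by rewrite exprn_ge0// subr_ge0.
have [ky|ky] := ltP (k%:R * y) 1.
  apply: (@squeeze_cvgr _ _ _ _ (fun n => 1 - n.+1%:R * (k%:R * y) ^+ n) (fun=> 1)).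
  - apply: nearW => n; apply/andP; split; last first.
      by rewrite exprn_ile1 ?subr_ge0// gerBl.
    rewrite -NE -mulrN; apply: bernoulli_le; rewrite lerN2; exact: yn1.
  - rewrite -[X in _ --> X]subr0; apply: cvgB; first exact: cvg_cst.
    by apply: cvg_natSMexp => //; rewrite mulr_ge0.
  - exact: cvg_cst.
apply: (@squeeze_cvgr _ _ _ _ (fun=> 0) (@harmonic R)); last exact: cvg_harmonic.
  apply: nearW => n; rewrite s0/= /harmonic/= -[leRHS]mul1r ler_pdivlMr ?ltr0n//.
  have := @bernoulli_le (y ^+ n) (n.+1 * k ^ n) (le_trans (lerN10 _) (yn0 n)).
  rewrite NE => h; apply: (@le_trans _ _ (((1 - y ^+ n) * (1 + y ^+ n)) ^+ (n.+1 * k ^ n))).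
    rewrite exprMn ler_wpM2l//; apply: le_trans h.
    rewrite -[leLHS]add0r lerD// -[leLHS]mulr1 ler_wpM2l//.
    by rewrite exprn_ege1.
  rewrite exprn_ile1//; first by rewrite mulr_ge0 ?subr_ge0 ?addr_ge0.
  have := mulr_ge0 (yn0 n) (yn0 n); lra.
exact: cvg_cst.
Qed.

End Steps.

Section Density.
Local Open Scope ereal_scope.
Context d (T : measurableType d) (R : realType).
Variables (mu : {measure set T -> \bar R}) (f : T -> \bar R).
Hypotheses (mf : measurable_fun [set: T] f) (f0 : forall x, 0 <= f x).

Definition density (A : set T) : \bar R := \int[mu]_(x in A) f x.

Let density0 : density set0 = 0.
Proof. by rewrite /density integral_set0. Qed.

Let density_ge0 A : 0 <= density A.
Proof. exact: integral_ge0. Qed.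

Let density_sigma_additive : semi_sigma_additive density.
Proof.
move=> F mF tF mUF; rewrite /density; apply: cvg_toP.
  apply: ereal_nondecreasing_is_cvgn => m n mn.
  by apply: lee_sum_nneg_natr => // k _ _; exact: integral_ge0.
by rewrite ge0_integral_bigcup//; exact: measurable_funTS.
Qed.

HB.instance Definition _ := isMeasure.Build _ _ _ density
  density0 density_ge0 density_sigma_additive.

Definition density_measure : {measure set T -> \bar R} := density.

End Density.

(** * The triplet of the extension *)

Section ExtendedTriplet.
Variable R : realType.
Implicit Types (p q s : {poly R}).

Lemma Rintegral_bounded_cvg (nu : {finite_measure set (measurableTypeR R) -> \bar R})
    (D : set R) (f_ : nat -> R -> R) (f : R -> R) (C : R) :
  measurable D -> (forall n, measurable_fun D (f_ n)) -> measurable_fun D f ->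
  (forall n x, D x -> `|f_ n x| <= C) ->
  (forall x, D x -> f_ n x @[n --> \oo] --> f x) ->
  \int[nu]_(x in D) f_ n x @[n --> \oo] --> \int[nu]_(x in D) f x.
Proof.
move=> mD mf_ mf f_C f_f.
pose F n x := (f_ n x)%:E; pose G x := (f x)%:E.
have mF n : measurable_fun D (F n) by exact/measurable_EFinP.
have mG : measurable_fun D G by exact/measurable_EFinP.
have FG : {ae nu, forall x, D x -> F n x @[n --> \oo] --> G x}.
  by apply: aeW => x Dx; apply: cvg_EFin; [exact: nearW|exact: f_f].
have iC : nu.-integrable D (cst C%:E) by exact: finite_measure_integrable_cst.
have FC : {ae nu, forall x n, D x -> (`|F n x| <= cst C%:E x)%E}.
  by apply: aeW => x n Dx; rewrite lee_fin; exact: f_C.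
have [intf _ cvi] := dominated_convergence (mu := nu) mD mF mG FG iC FC.
have intfin : (\int[nu]_(x in D) (f x)%:E)%E \is a fin_num.
  exact: integrable_fin_num.
rewrite /Rintegral; apply: fine_cvg; rewrite fineK//.
Qed.

Lemma horner_bounded (M : R) p : exists C : R, forall x : R, x \in `[0, M] -> `|p.[x]| <= C.
Proof.
exists (\sum_(i < size p) `|p`_i| * M ^+ i) => x; rewrite in_itv/= => /andP[x0 xM].
rewrite horner_coef (le_trans (ler_norm_sum _ _ _))//; apply: ler_sum => i _.
by rewrite normrM normrX (ger0_norm x0) ler_wpM2l// lerXn2r ?nnegrE// (le_trans x0).
Qed.

Section TwoTriplets.
Variables (lambda : weights R) (b c t bt ct M : R) (t0 : 0 < t).
Variables nu nut : {finite_measure set (measurableTypeR R) -> \bar R}.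
Hypotheses (M1 : 1 < M) (nuM : supported nu M) (nutM : supported nut M).
Hypothesis tri : scalar_triplet lambda b c nu.
Hypothesis trit : scalar_triplet (cons_weights t0 lambda) bt ct nut.

Let M0 : 0 < M. Proof. exact: lt_trans M1. Qed.
Let I1 : `[0, M]%classic 1. Proof. by rewrite /= in_itv/= ler01 ltW. Qed.

(** Equality of all moments of the measures x dnut + 2 ct delta_1 and
    t^2 (dnu + 2 c delta_1). *)
Lemma shift_moments p :
  pint nut M ('X * p) + 2 * ct * p.[1] = t ^+ 2 * (pint nu M p + 2 * c * p.[1]).
Proof.
have := riesz_cons t nuM tri 0 p.
rewrite polyC0 add0r mul0r add0r => <-.
by rewrite (triplet_riesz nutM trit) hornerM hornerX mul1r.
Qed.

(** Equality of moments extends to bounded pointwise limits of polynomials on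
    [0, M], by dominated convergence on both sides. *)
Lemma shift_bounded_limit (p_ : nat -> {poly R}) (f : R -> R) (C : R) :
  measurable_fun `[0, M] f ->
  (forall n (x : R), x \in `[0, M] -> `|(p_ n).[x]| <= C) ->
  (forall x : R, x \in `[0, M] -> (p_ n).[x] @[n --> \oo] --> f x) ->
  \int[nut]_(x in `[0, M]) (x * f x) + 2 * ct * f 1 =
  t ^+ 2 * (\int[nu]_(x in `[0, M]) f x + 2 * c * f 1).
Proof.
move=> mf pC pf.
have mp p : measurable_fun (`[0, M] : set R) (horner p).
  by apply: measurable_funTS; exact: (continuous_measurable_fun (@continuous_horner R p)).
have cl : pint nut M ('X * p_ n) + 2 * ct * (p_ n).[1] @[n --> \oo] -->
   \int[nut]_(x in `[0, M]) (x * f x) + 2 * ct * f 1.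
  apply: cvgD; last by apply: cvgMr; exact: pf I1.
  apply: (@Rintegral_bounded_cvg _ _ _ _ (M * C)) => //.
  - exact: measurable_funM.
  - move=> n x Ix; rewrite hornerM hornerX normrM; have := Ix.
    rewrite /= in_itv/= => /andP[x0 xM].
    by apply: ler_pM => //; [rewrite ger0_norm|exact: pC Ix].
  - move=> x Ix; under eq_cvg do rewrite hornerM hornerX.
    by apply: cvgMr; exact: pf Ix.
have cr : pint nut M ('X * p_ n) + 2 * ct * (p_ n).[1] @[n --> \oo] -->
   t ^+ 2 * (\int[nu]_(x in `[0, M]) f x + 2 * c * f 1).
  under eq_cvg do rewrite shift_moments.
  apply: cvgMr; apply: cvgD; last by apply: cvgMr; exact: pf I1.
  exact: (@Rintegral_bounded_cvg _ _ _ _ C).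
exact: (cvg_unique (@Rhausdorff R) cl cr).
Qed.

Lemma Rintegral_null1 (mu : {finite_measure set (measurableTypeR R) -> \bar R}) (g : R -> R) :
  mu [set 1] = 0%E -> (forall x, x != 1 -> g x = 0) ->
  \int[mu]_(x in `[0, M]) g x = 0.
Proof.
move=> mu1 g1; pose N : set R := [set 1].
have mN : measurable N by exact: measurable_set1.
have gN : g = g \_ N.
  apply/funext => x; rewrite patchE; case: ifPn => //.
  by rewrite notin_setE => /eqP; exact: g1.
rewrite gN -Rintegral_mkcondr /Rintegral null_set_integral//.
- exact: measurableI.
- by apply: (measurable_funS mN); [move=> x [] | exact: measurable_fun_set1].
- by apply: (subset_measure0 _ _ _ mu1) => //; exact: measurableI.
Qed.

(** The polynomials (1 - ((x - 1) / M)^2)^n converge boundedly on [0, M] to the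
    indicator of 1, where neither nu nor nut has mass. *)
Lemma triplet_shift_ct : ct = t ^+ 2 * c.
Proof.
pose p n : {poly R} := (1 - (M ^-1 *: ('X - 1)) ^+ 2) ^+ n.
have pE n x : (p n).[x] = (1 - ((x - 1) / M) ^+ 2) ^+ n.
  by rewrite /p !hornerE mulrC.
have base (x : R) : x \in `[0, M] -> 0 <= 1 - ((x - 1) / M) ^+ 2 <= 1.
  rewrite in_itv/= => /andP[x0 xM]; rewrite gerBl sqr_ge0 andbT subr_ge0.
  rewrite -real_normK ?num_real// -[leRHS](expr1n _ 2) lerXn2r ?nnegrE//.
  rewrite normrM normfV (gtr0_norm M0) ler_pdivrMr// mul1r ler_norml.
  by have := M1 => M1'; apply/andP; split; lra.
have nut1 : nut [set 1] = 0%E by case: trit.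
have nu1 : nu [set 1] = 0%E by case: tri.
have := @shift_bounded_limit p (fun x => (x == 1)%:R) 1.
rewrite eqxx (Rintegral_null1 nut1) => [|x /negbTE ->]; last by rewrite mulr0.
rewrite (Rintegral_null1 nu1) => [|x /negbTE -> //].
rewrite !add0r !mulr1 => h; suff : 2 * ct = t ^+ 2 * (2 * c) by lra.
apply: h => [|n x Ix|x Ix].
- apply: (@measurableT_comp _ _ _ _ _ _ (fun b : bool => b%:R : R)) => //.
  exact: measurable_fun_eqr.
- by rewrite pE; have /andP[h0 h1] := base x Ix; rewrite ger0_norm ?exprn_ge0// exprn_ile1.
- have /andP[h0 h1] := base x Ix.
  have -> : (fun n => (p n).[x]) = fun n => (1 - ((x - 1) / M) ^+ 2) ^+ n.
    by apply/funext => n; exact: pE.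
  have [->|x1] := eqVneq x 1.
    rewrite subrr mul0r expr0n subr0; under eq_fun do rewrite expr1n.
    exact: cvg_cst.
  apply: cvg_expr; rewrite ger0_norm// gtrBl exprn_even_gt0//= mulf_neq0 ?subr_eq0//.
  by rewrite invr_eq0 gt_eqF.
Qed.

(** The indicator of x < a is a bounded limit of polynomials on [0, M]: take
    the steps above in the variable y = x / (k a), with k so large that y <= 1
    on [0, M]; the jump y = 1/k is at x = a. *)
Lemma shift_cut_moments (a : R) p :
  \int[nut]_(x in `[0, M] `&` `]-oo, a[) (x * p.[x]) =
  t ^+ 2 * \int[nu]_(x in `[0, M] `&` `]-oo, a[) p.[x].
Proof.
have [a0|a0] := leP a 0.
  rewrite (_ : _ `&` _ = set0) ?Rintegral_set0 ?mulr0//.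
  by rewrite -subset0 => x []/=; rewrite !in_itv/= => /andP[x0 _] xa; lra.
pose k := (Num.trunc (M / a)).+1.
have kaM : M <= k%:R * a by rewrite -ler_pdivrMr// ltW// truncnS_gt.
have k0 : 0 < k%:R :> R by [].
have ka0 : 0 < k%:R * a by rewrite mulr_gt0.
pose q n : {poly R} := p * (1 - ((k%:R * a)^-1 *: 'X) ^+ n) ^+ (n.+1 * k ^ n).
have qE n x : (q n).[x] = p.[x] * (1 - (x / (k%:R * a)) ^+ n) ^+ (n.+1 * k ^ n).
  by rewrite [x / _]mulrC /q !hornerE.
have [C pC] := horner_bounded M p.
have mp : measurable_fun [set: R] (horner p).
  exact: (continuous_measurable_fun (@continuous_horner R p)).
have base (x : R) : x \in `[0, M] -> 0 <= x / (k%:R * a) <= 1.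
  rewrite in_itv/= => /andP[x0 xM]; rewrite divr_ge0 ?(ltW ka0)//=.
  by rewrite ler_pdivrMr// mul1r (le_trans xM).
have := @shift_bounded_limit q ((horner p) \_ `]-oo, a[) C.
rewrite -Rintegral_mkcondr triplet_shift_ct => h.
rewrite [LHS]Rintegral_mkcondr.
have -> : (fun x => x * p.[x]) \_ `]-oo, a[ = fun x => x * (horner p \_ `]-oo, a[) x.
  by apply/funext => x; rewrite !patchE; case: ifP => //; rewrite mulr0.
pose f := horner p \_ `]-oo, a[.
suff : \int[nut]_(x in `[0, M]) (x * f x) + 2 * (t ^+ 2 * c) * f 1 =
   t ^+ 2 * (\int[nu]_(x in `[0, M] `&` `]-oo, a[) p.[x] + 2 * c * f 1).
  by rewrite /f; lra.
apply: h => [|n x Ix|x Ix].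
- by apply/measurable_restrict => //; exact: measurable_funTS.
- have /andP[y0 y1] := base x Ix.
  have u0 : 0 <= 1 - (x / (k%:R * a)) ^+ n by rewrite subr_ge0 exprn_ile1.
  have u1 : 1 - (x / (k%:R * a)) ^+ n <= 1 by rewrite gerBl exprn_ge0.
  rewrite qE normrM -[leRHS]mulr1; apply: ler_pM => //; first exact: pC.
  by rewrite ger0_norm ?exprn_ge0// exprn_ile1.
- have /andP[y0 y1] := base x Ix.
  have -> : (fun n => (q n).[x]) =
      fun n => p.[x] * (1 - (x / (k%:R * a)) ^+ n) ^+ (n.+1 * k ^ n).
    by apply/funext => n; exact: qE.
  have -> : (horner p \_ `]-oo, a[) x = p.[x] * ((k%:R * (x / (k%:R * a)) < 1)%R%:R).
    rewrite invfM mulrCA mulVKf ?gt_eqF// ltr_pdivrMr// mul1r patchE.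
    by rewrite mem_setE in_itv/=; case: ifP; rewrite ?mulr1 ?mulr0.
  by apply: cvgMr; exact: step_cvg.
Qed.

(** Taking for the polynomial the truncated Neumann series of 1/x, the factor
    x on the left cancels in the limit except at 0. *)
Lemma shift_cut_measure (a : R) :
  (nut (`[0%R, M] `&` `]-oo, a[ `&` ~` [set 0%R]) =
  (t ^+ 2)%:E * \int[nu]_(x in `[0%R, M] `&` `]-oo, a[) (x%:E)^-1)%E.
Proof.
set D : set R := `[0, M] `&` `]-oo, a[.
have mD : measurable D by apply: measurableI.
have DM : D `<=` `[0, M] by move=> x [].
have Mn0 : M != 0 by rewrite gt_eqF.
have integ (mu : {finite_measure set (measurableTypeR R) -> \bar R}) p :
    ((\int[mu]_(x in D) p.[x])%:E = \int[mu]_(x in D) (p.[x])%:E)%E.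
  rewrite /Rintegral fineK// integrable_fin_num//.
  exact: integrableS (poly_integrable mu M p).
have cr := cvgeZl (y := (t ^+ 2)%:E) isT (invpoly_integral_cvg (nu := nu) M0 mD DM).
have cl : (\int[nut]_(x in D) (('X * invpoly M m).[x])%:E @[m --> \oo] -->
    nut (D `&` ~` [set 0%R]))%E.
  have mN : measurable (~` [set 0 : R]) by apply: measurableC; exact: measurable_set1.
  have -> : nut (D `&` ~` [set 0]) = (\int[nut]_(x in D) \1_(~` [set 0 : R]) x)%:E.
    by rewrite /Rintegral integral_indic// setIC fineK// fin_num_measure//; exact: measurableI.
  under eq_cvg do rewrite -integ.
  apply: cvg_EFin; first exact: nearW.
  have xE m x : ('X * invpoly M m).[x] = 1 - (1 - x / M) ^+ m.
    by rewrite hornerM hornerX invpolyE.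
  have z01 x : D x -> 0 <= 1 - x / M <= 1.
    move=> /DM; rewrite /= in_itv/= => /andP[x0 xM].
    rewrite gerBl divr_ge0 ?(ltW M0)// andbT subr_ge0.
    by rewrite ler_pdivrMr// mul1r.
  apply: (@Rintegral_bounded_cvg _ _ _ _ 1) => //.
  - move=> m; apply: measurable_funTS.
    exact: (continuous_measurable_fun (@continuous_horner R _)).
  - move=> m x Dx; have /andP[z0 z1] := z01 _ Dx; rewrite xE.
    have u1 : (1 - x / M) ^+ m <= 1 by rewrite exprn_ile1.
    by rewrite ger0_norm ?subr_ge0// gerBl exprn_ge0.
  move=> x Dx; have /andP[z0 z1] := z01 _ Dx.
  have -> : (fun m => ('X * invpoly M m).[x]) = fun m => 1 - (1 - x / M) ^+ m.
    by apply/funext.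
  rewrite indicE; have [->|x0] := eqVneq x 0.
    rewrite memNset; last by move=> /(_ erefl).
    rewrite mul0r subr0; under eq_fun do rewrite expr1n subrr; exact: cvg_cst.
  rewrite mem_set; last exact/eqP.
  rewrite -[X in _ --> X]subr0; apply: cvgB; first exact: cvg_cst.
  apply: cvg_expr; rewrite ger0_norm// ltrBlDr ltrDl divr_gt0//.
  by rewrite lt_neqAle eq_sym x0; have := DM _ Dx; rewrite /= in_itv/= => /andP[].
apply: (cvg_unique (@ereal_hausdorff R) cl).
have -> : (fun m => \int[nut]_(x in D) (('X * invpoly M m).[x])%:E)%E =
    (fun m => (t ^+ 2)%:E * \int[nu]_(x in D) ((invpoly M m).[x])%:E)%E.
  apply/funext => m; rewrite -!integ -EFinM -shift_cut_moments; congr EFin.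
  by apply: eq_Rintegral => x _; rewrite hornerM hornerX.
exact: cr.
Qed.

(** Both sides are measures in D which agree on the half-lines ]-oo, a[. The
    absolute value makes the density nonnegative on the whole line. *)
Lemma triplet_shift_off0 (D : set (measurableTypeR R)) : measurable D ->
  (nut (D `&` (`[0%R, M] `\ 0%R)) =
   (t ^+ 2)%:E * \int[nu]_(x in D `&` `[0%R, M]) (x%:E)^-1)%E.
Proof.
move=> mD; pose f (x : measurableTypeR R) : \bar R := ((`|x : R|%R)%:E^-1)%E.
have mf : measurable_fun [set: measurableTypeR R] f.
  have mn : measurable_fun [set: R] (@Num.norm R R) by exact: normr_measurable.
  exact: (measurableT_comp (@measurable_inve R) mn).
have f0 x : (0 <= f x)%E by exact: ge0_inve.
have mI : measurable (`[0, M]%classic : set (measurableTypeR R)) by exact: measurable_itv.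
have mI0 : measurable (`[0, M] `\ 0 : set (measurableTypeR R)).
  by apply: measurableD => //; exact: measurable_set1.
have t20 : 0 <= t ^+ 2 by rewrite sqr_ge0.
pose m1 : {measure set (measurableTypeR R) -> \bar R} := mrestr nut mI0.
pose m2 : {measure set (measurableTypeR R) -> \bar R} :=
  mscale (NngNum t20) (mrestr (density_measure nu mf f0) mI).
have m2E A : m2 A = ((t ^+ 2)%:E * \int[nu]_(x in A `&` `[0%R, M]) (x%:E)^-1)%E.
  rewrite /m2 /= /mscale/= /mrestr/= /density; congr (_ * _)%E.
  apply: eq_integral => x; rewrite inE => -[_] /=; rewrite in_itv/= => /andP[x0 _].
  by rewrite /f ger0_norm.
rewrite -m2E -[LHS]/(m1 D).
pose g n : set (measurableTypeR R) := `]-oo, n%:R[%classic.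
apply: (@measure_unique _ R (measurableTypeR R) (@RGenInftyO.G R) g
  _ _ _ _ m1 m2 _ _ D mD).
- exact: RGenInftyO.measurableE.
- move=> _ _ [x ->] [y ->]; exists (Num.min x y).
  by apply/seteqP; split=> z /=; rewrite !in_itv/= lt_min => /andP.
- by move=> n; exists n%:R.
- apply/seteqP; split=> // x _; exists (Num.trunc `|x|).+1 => //.
  by rewrite /g /= in_itv/= (le_lt_trans (ler_norm x))// truncnS_gt.
- move=> _ [a ->]; rewrite m2E setIC -shift_cut_measure /m1 /= /mrestr.
  by congr (nut _); rewrite setDE setIA (setIC `[0, M]%classic).
- move=> n; rewrite /m1 /= /mrestr ltey_eq fin_num_measure//.
  by apply: measurableI => //; exact: measurable_itv.
Qed.

Lemma Qpoly1 : Qpoly R 1 = 0.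
Proof. by rewrite /Qpoly poly_def big_ord0. Qed.

Lemma triplet_shift_bt : bt = t ^+ 2 * (1 - c) - 1.
Proof.
have := triplet_lambda_hat nutM trit 1.
rewrite Qpoly1 linear0 lambda_hat_cons /lambda_hat big_ord0 triplet_shift_ct; lra.
Qed.

Lemma pint1 (mu : {finite_measure set (measurableTypeR R) -> \bar R}) :
  (pint mu M 1)%:E = mu `[0, M]%classic.
Proof.
rewrite EFin_pint; under eq_integral do rewrite hornerC.
by rewrite integral_cst ?mul1e.
Qed.

Lemma supported_measure (mu : {finite_measure set (measurableTypeR R) -> \bar R})
    (D : set (measurableTypeR R)) : supported mu M -> measurable D ->
  mu D = mu (D `&` `[0, M]%classic).
Proof.
move=> muM mD; rewrite (measureDI mu mD (measurable_itv `[0, M])).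
rewrite [X in (X + _)%E](subset_measure0 _ _ _ muM) ?add0e//.
- by apply: measurableD.
- exact: measurableC.
Qed.

Lemma triplet_shift_measure (D : set (measurableTypeR R)) :
  measurable D -> D `<=` `[0, +oo[ ->
  (nut D = (t ^+ 2)%:E * \int[nu]_(x in D) (x%:E)^-1
     + nut [set 0%R] * \d_(0%R : measurableTypeR R) D)%E.
Proof.
move=> mD D0.
have m0 : measurable ([set 0] : set (measurableTypeR R)) by exact: measurable_set1.
rewrite (supported_integral nuM mD); first last.
- by move=> x /D0; rewrite /= in_itv/= andbT; exact: ge0_inve.
- by apply: measurable_funTS; exact: measurable_inve.
rewrite -triplet_shift_off0// (supported_measure nutM mD).
have mDI : measurable (D `&` `[0, M]%classic) by apply: measurableI => //; exact: measurable_itv.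
rewrite (measureDI nut mDI m0) setDE -setIA -setDE; congr (_ + _)%E.
rewrite diracE; have [D00|D00] := boolP (0 \in D).
  rewrite mule1; congr (nut _); apply/seteqP; split=> x /=; first by case.
  move=> ->; split=> //; split; first by rewrite inE in D00.
  by rewrite in_itv/= lexx ltW.
rewrite mule0 (_ : _ `&` _ = set0) ?measure0//.
by rewrite -subset0 => x [[Dx _] /= x0]; move/negP: D00; apply; rewrite inE -x0.
Qed.

(** The density of nut with respect to nu is infinite at 0, while nut is
    finite. *)
Lemma triplet_shift_nu0 : nu [set 0] = 0%E.
Proof.
have m0 : measurable ([set 0] : set (measurableTypeR R)) by exact: measurable_set1.
have := triplet_shift_off0 m0.
rewrite (_ : [set 0] `&` (_ `\ _) = set0); last first.
  by rewrite -subset0 => x [-> [_]] /=.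
rewrite measure0 setIidl; last by move=> x /= ->; rewrite in_itv/= lexx ltW.
rewrite (_ : integral _ _ _ = \int[nu]_(x in [set 0%R]) +oo)%E; last first.
  by apply: eq_integral => x; rewrite inE => -> /=; rewrite inve0.
rewrite integral_cst//= => /esym/eqP; rewrite mule_eq0 => /orP[|].
  by rewrite eqe sqrf_eq0 gt_eqF.
by rewrite mule_eq0 => /orP[//|/eqP].
Qed.

(** The total mass of nut is read off the first second difference of the
    moments of the extension; the density accounts for the mass off 0. In
    particular the integral of 1/x is finite. *)
Lemma triplet_shift_nut0 : nut [set 0] =
  (1 - (t ^+ 2)%:E * (\int[nu]_(x in `[0%R, +oo[) (x%:E)^-1 + (1 + c - b)%:E))%E.
Proof.
have mI : measurable (`[0, M]%classic : set (measurableTypeR R)) by exact: measurable_itv.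
have I0y : (`[0, M] : set R) `<=` `[0, +oo[.
  by move=> x; rewrite /= !in_itv/= andbT => /andP[].
have := triplet_shift_measure mI I0y.
rewrite -integral_inve_supported// -pint1.
rewrite diracE mem_set ?mule1; last by rewrite /= in_itv/= lexx ltW.
have -> : pint nut M 1 = 1 + t ^+ 2 * (b + c - 1) - 2 * ct.
  have := riesz_cons t nuM tri 1 0.
  rewrite mulr0 addr0 linear0 horner0 mulr0 addr0 mulr0 addr0 mul1r => <-.
  by rewrite (triplet_riesz nutM trit) hornerC; ring.
set J := integral _ _ _; set n0 := nut [set 0].
have J0 : (0 <= J)%E.
  by apply: integral_ge0 => x; rewrite /= in_itv/= andbT; exact: ge0_inve.
have n0f : n0 \is a fin_num by apply: fin_num_measure; exact: measurable_set1.
have t2 : 0 < t ^+ 2 by rewrite exprn_gt0.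
rewrite -(fineK n0f); case: J J0 => [J||] // J0.
  rewrite -EFinM -EFinD => -[E].
  rewrite -[RHS]/((1 - t ^+ 2 * (J + (1 + c - b)))%:E).
  by congr EFin; rewrite triplet_shift_ct in E; lra.
by rewrite gt0_muley ?lte_fin.
Qed.

End TwoTriplets.
End ExtendedTriplet.

(** * Backward extensions of conditionally positive definite shifts *)

(* In \bar R the inverse of 0 is +oo. *)
Theorem theorem7p2 (R : realType) (lambda : weights R) (b c : R)
    (nu : {finite_measure set (measurableTypeR R) -> \bar R})
    (lambda_cpd : cpd_operator (weighted_shift lambda))
    (lambda_triplet : scalar_triplet lambda b c nu)
    (t : R) (t_gt0 : 0 < t) :
  (cpd_operator (weighted_shift (cons_weights t_gt0 lambda)) <->
   (\int[nu]_(x in `[0%R, +oo[) (x%:E)^-1 + (1 + c - b)%:E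
      <= ((t ^+ 2)^-1)%:E)%E) /\
  (cpd_operator (weighted_shift (cons_weights t_gt0 lambda)) ->
   forall (bt ct : R)
     (nut : {finite_measure set (measurableTypeR R) -> \bar R}),
     scalar_triplet (cons_weights t_gt0 lambda) bt ct nut ->
     [/\ nu [set 0] = 0%E,
         bt = t ^+ 2 * (1 - c) - 1,
         ct = t ^+ 2 * c,
         forall D : set (measurableTypeR R), measurable D -> D `<=` `[0, +oo[ ->
           nut D = ((t ^+ 2)%:E * \int[nu]_(x in D) (x%:E)^-1
                    + nut [set 0%R] * \d_(0%R : measurableTypeR R) D)%E &
         nut [set 0] =
           (1 - (t ^+ 2)%:E *
              (\int[nu]_(x in `[0%R, +oo[) (x%:E)^-1 + (1 + c - b)%:E))%E]).
Proof.
have tri := lambda_triplet.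
have nearM := triplet_supported tri.
split=> [|_ bt ct nut trit].
  have [M [M1 nuM]] : exists M, 1 < M /\ supported nu M.
    near (+oo : set_system R) => M; exists M; split; near: M => //.
    exact: nbhs_pinfty_gt.
  rewrite (cpd_cons_shift _ lambda_cpd); split.
    exact: (cpd_cons_necessary M1 nuM tri t_gt0).
  by apply: (cpd_cons_sufficient nuM tri t_gt0); case: tri.
have [M [M1 nuM nutM]] : exists M, [/\ 1 < M, supported nu M & supported nut M].
  have := triplet_supported trit => neart.
  near (+oo : set_system R) => M; exists M; split; near: M => //.
  exact: nbhs_pinfty_gt.
split.
- exact: (triplet_shift_nu0 M1 nuM nutM tri trit).
- exact: (triplet_shift_bt M1 nuM nutM tri trit).
- exact: (triplet_shift_ct M1 nuM nutM tri trit).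
- exact: (triplet_shift_measure M1 nuM nutM tri trit).
- exact: (triplet_shift_nut0 M1 nuM nutM tri trit).
Unshelve. all: by end_near. Qed.
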